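(* Let $p,q$ be integers. The generating function $h^{(2)}(x)=\sum_{n=0}^{\infty}V_n^{(2)}x^n$ (as a formal power series) satisfies $$h^{(2)}(x)=\frac{4-2px-p^{2}x^{2}+2pqx^{3}}{1-px+pqx^{3}-q^{2}x^{4}}.$$
   Context: For integers $p,q$, let $\Delta=p^2-4q$, $\alpha=\frac{p+\sqrt{\Delta}}{2}$, $\beta=\frac{p-\sqrt{\Delta}}{2}$, and $V_n=\alpha^n+\beta^n$ (so $V_0=2$, $V_1=p$, $V_n=pV_{n-1}-qV_{n-2}$). For $n=2m+r$ with $m\geq0$, $r\in\{0,1\}$, define $V_n^{(2)}=(\alpha^{m+1}+\beta^{m+1})^{r}(\alpha^{m}+\beta^{m})^{2-r}$; equivalently $V_{2m}^{(2)}=V_m^2$ and $V_{2m+1}^{(2)}=V_mV_{m+1}$. *)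

(* Defs.v *)
From HB Require Import structures.
From mathcomp Require Import all_boot all_order all_algebra.
From mathcomp Require Import boolp.

Set Implicit Arguments.
Unset Strict Implicit.
Unset Printing Implicit Defensive.

Import Order.TTheory GRing.Theory Num.Theory.

Local Open Scope ring_scope.

(* The formal power series \sum_n f_n x^n over R, given by its coefficient
   sequence. It is a wrapper, not a bare [nat -> R], because functions already
   carry the pointwise product. *)
Record fps (R : Type) := FPS { coefs : nat -> R }.

Lemma fpsP (R : Type) (f g : fps R) : coefs f =1 coefs g -> f = g.
Proof. by case: f g => [f] [g] /= /funext ->. Qed.

HB.instance Definition _ (R : Type) := gen_eqMixin (fps R).
HB.instance Definition _ (R : Type) := gen_choiceMixin (fps R).

Section FpsRing.
Variable R : comNzRingType.
Implicit Types f g h : fps R.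

Definition fps_zero : fps R := FPS (fun=> 0).
Definition fps_opp f : fps R := FPS (fun n => - coefs f n).
Definition fps_add f g : fps R := FPS (fun n => coefs f n + coefs g n).
Definition fps_one : fps R := FPS (fun n => (n == 0)%:R).
Definition fps_mul f g : fps R :=
  FPS (fun n => \sum_(i < n.+1) coefs f i * coefs g (n - i)).

Fact fps_addA : associative fps_add.
Proof. by move=> f g h; apply: fpsP => n /=; rewrite addrA. Qed.
Fact fps_addC : commutative fps_add.
Proof. by move=> f g; apply: fpsP => n /=; rewrite addrC. Qed.
Fact fps_add0 : left_id fps_zero fps_add.
Proof. by move=> f; apply: fpsP => n /=; rewrite add0r. Qed.
Fact fps_addN : left_inverse fps_zero fps_opp fps_add.
Proof. by move=> f; apply: fpsP => n /=; rewrite addNr. Qed.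

HB.instance Definition _ :=
  GRing.isZmodule.Build (fps R) fps_addA fps_addC fps_add0 fps_addN.

Let trunc n f : {poly R} := \poly_(i < n.+1) coefs f i.

Let coef_trunc n f i : (i <= n)%N -> (trunc n f)`_i = coefs f i.
Proof. by move=> le_in; rewrite coef_poly ltnS le_in. Qed.

Let coef_trunc_mul n f g i :
  (i <= n)%N -> (trunc n f * trunc n g)`_i = coefs (fps_mul f g) i.
Proof.
move=> le_in; rewrite coefM; apply: eq_bigr => j _.
have le_jn : (j <= n)%N by apply: leq_trans le_in; rewrite -ltnS.
by rewrite !coef_trunc // (leq_trans (leq_subr _ _)).
Qed.

Fact fps_mulA : associative fps_mul.
Proof.
move=> f g h; apply: fpsP => n.
transitivity (trunc n f * trunc n g * trunc n h)`_n.
  rewrite -mulrA coefM; apply: eq_bigr => i _.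
  by rewrite coef_trunc ?coef_trunc_mul ?leq_subr // -ltnS.
rewrite coefM; apply: eq_bigr => i _.
by rewrite coef_trunc ?coef_trunc_mul ?leq_subr // -ltnS.
Qed.
Fact fps_mulC : commutative fps_mul.
Proof.
by move=> f g; apply: fpsP => n; rewrite -!(@coef_trunc_mul n) // mulrC.
Qed.
Fact fps_mul1 : left_id fps_one fps_mul.
Proof.
move=> f; apply: fpsP => n /=; rewrite big_ord_recl /= mul1r subn0.
by rewrite big1 ?addr0 // => i _; rewrite mul0r.
Qed.
Fact fps_mulDl : left_distributive fps_mul fps_add.
Proof.
move=> f g h; apply: fpsP => n /=; rewrite -big_split.
by apply: eq_bigr => i _; rewrite mulrDl.
Qed.
Fact fps_oner_neq0 : fps_one != 0.
Proof.
apply/eqP => /(congr1 (fun f => coefs f 0)) /= /eqP.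
by rewrite oner_eq0.
Qed.

HB.instance Definition _ := GRing.Zmodule_isComNzRing.Build (fps R)
  fps_mulA fps_mulC fps_mul1 fps_mulDl fps_oner_neq0.

Definition fpsX : fps R := FPS (fun n => (n == 1)%:R).

Lemma coef_fps0 n : coefs (0 : fps R) n = 0. Proof. by []. Qed.
Lemma coef_fps1 n : coefs (1 : fps R) n = (n == 0)%:R. Proof. by []. Qed.
Lemma coef_fpsN f n : coefs (- f) n = - coefs f n. Proof. by []. Qed.
Lemma coef_fpsD f g n : coefs (f + g) n = coefs f n + coefs g n.
Proof. by []. Qed.
Lemma coef_fpsM f g n :
  coefs (f * g) n = \sum_(i < n.+1) coefs f i * coefs g (n - i).
Proof. by []. Qed.

Lemma coef_fpsXM f n : coefs (fpsX * f) n = if n is m.+1 then coefs f m else 0.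
Proof.
case: n => [|n]; rewrite coef_fpsM; first by rewrite big_ord1 mul0r.
rewrite big_ord_recl mul0r add0r big_ord_recl lift0 subSS subn0 mul1r.
by rewrite big1 ?addr0 // => i _; rewrite mul0r.
Qed.
Lemma coef_fps_int (c : int) n :
  coefs (c%:~R : fps R) n = if n == 0 then c%:~R else 0.
Proof.
have nat_fps k : coefs (k%:R : fps R) n = if n == 0 then k%:R else 0.
  elim: k => [|k IHk]; first by rewrite if_same.
  by rewrite !mulrS coef_fpsD coef_fps1 IHk; case: eqP; rewrite ?addr0.
case: c => k; first exact: nat_fps.
by rewrite NegzE !mulrNz coef_fpsN nat_fps; case: eqP; rewrite ?oppr0.
Qed.

End FpsRing.

Section FpsUnitRing.
Variable R : comUnitRingType.
Implicit Types f g : fps R.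

(* The first n + 1 coefficients of 1 / f, from the recurrence
   g_0 = 1 / f_0, g_(n+1) = - (f_1 g_n + ... + f_(n+1) g_0) / f_0. *)
Fixpoint fps_inv_seq f n : seq R :=
  if n is m.+1 then
    let s := fps_inv_seq f m in
    rcons s (- (coefs f 0)^-1 * \sum_(i < m.+1) coefs f i.+1 * s`_(m - i))
  else [:: (coefs f 0)^-1].

(* As everywhere in MathComp, the inverse of a non-unit is itself. *)
Definition fps_unit : {pred fps R} := fun f => coefs f 0 \is a GRing.unit.
Definition fps_inv f : fps R :=
  if fps_unit f then FPS (fun n => (fps_inv_seq f n)`_n) else f.

Let size_inv_seq f n : size (fps_inv_seq f n) = n.+1.
Proof. by elim: n => //= n IHn; rewrite size_rcons IHn. Qed.

Let nth_inv_seq f n i :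
  (i <= n)%N -> (fps_inv_seq f n)`_i = (fps_inv_seq f i)`_i.
Proof.
elim: n => [|n IHn]; first by rewrite leqn0 => /eqP->.
rewrite leq_eqVlt ltnS => /orP[/eqP-> //|le_in].
by rewrite /= nth_rcons size_inv_seq ltnS le_in IHn.
Qed.

Fact fps_mulVr : {in fps_unit, left_inverse 1 fps_inv *%R}.
Proof.
move=> f Uf; have Uf0 : coefs f 0 \is a GRing.unit by [].
rewrite /fps_inv ifT // mulrC; apply: fpsP => -[|n].
  by rewrite coef_fpsM big_ord1 /= divrr.
rewrite coef_fpsM big_ord_recl subn0.
rewrite [coefs _ n.+1]/= nth_rcons size_inv_seq ltnn eqxx.
rewrite [coefs f ord0 * _]mulrA mulrN divrr // mulN1r addrC.
apply/eqP; rewrite subr_eq0; apply/eqP; apply: eq_bigr => i _.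
by rewrite lift0 subSS /= [in RHS]nth_inv_seq ?leq_subr.
Qed.
Fact fps_unitPl f g : g * f = 1 -> fps_unit f.
Proof.
move/(congr1 (fun h => coefs h 0)); rewrite coef_fpsM big_ord1 /= => gf1.
by apply/unitrPr; exists (coefs g 0); rewrite mulrC.
Qed.
Fact fps_invr_out : {in [predC fps_unit], fps_inv =1 id}.
Proof. by move=> f nUf; rewrite /fps_inv ifN. Qed.

HB.instance Definition _ := GRing.ComNzRing_hasMulInverse.Build (fps R)
  fps_mulVr fps_unitPl fps_invr_out.

Lemma fps_unitE f : (f \is a GRing.unit) = (coefs f 0 \is a GRing.unit).
Proof. by []. Qed.

End FpsUnitRing.

Notation "{ 'fps' R }" := (fps R) (format "{ 'fps'  R }").

(* [C] stands for the complex numbers; any [numClosedFieldType] will do, and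
   both [algC] and [R[i]] over a real closed field R are instances. *)
Section Lucas.
Variables (C : numClosedFieldType) (p q : int).

Definition discr : int := p ^+ 2 - 4 * q.

Definition alpha : C := (p%:~R + sqrtC (discr%:~R)) / 2.
Definition beta : C := (p%:~R - sqrtC (discr%:~R)) / 2.

Definition lucasV (n : nat) : C := alpha ^+ n + beta ^+ n.

(* The Euclidean division n = 2 m + r, r in {0, 1}. *)
Definition lucasV2 (n : nat) : C :=
  let m := n./2 in let r : nat := odd n in
  lucasV m.+1 ^+ r * lucasV m ^+ (2 - r).

Definition gen_lucasV2 : {fps C} := FPS lucasV2.

End Lucas.

(* Main.v *)
Require Import Defs.
From HB Require Import structures.
From mathcomp Require Import all_boot all_order all_algebra.
From mathcomp Require Import ring.

Import Order.TTheory GRing.Theory Num.Theory.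
Local Open Scope ring_scope.

(** Clearing the denominator, the identity says that the coefficients satisfy
    [V2_n = p V2_(n-1) - p q V2_(n-3) + q^2 V2_(n-4)] for [n >= 4]. For
    [n = 2 m] (resp. [n = 2 m + 1]) this follows from two uses of
    [V_k = p V_(k-1) - q V_(k-2)]: one turns [V2_n - p V2_(n-1)] into
    [- q V_(m-2) V_m] (resp. [- q V_(m-1) V_m]), the other expands [V_m]. *)

(** An integer is a constant series, so only the index 0 term of the Cauchy product survives. *)
Lemma coef_fps_intM (R : comNzRingType) (c : int) (f : {fps R}) n :
  coefs (c%:~R * f) n = c%:~R * coefs f n.
Proof.
rewrite coef_fpsM big_ord_recl subn0 coef_fps_int /= big1 ?addr0 // => i _.
by rewrite coef_fps_int mul0r.
Qed.

Section LucasRecurrence.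
Variables (C : numClosedFieldType) (p q : int).

Local Notation V := (lucasV C p q).
Local Notation V2 := (lucasV2 C p q).

Lemma alphaDbeta : alpha C p q + beta C p q = p%:~R.
Proof. by rewrite /alpha /beta; field. Qed.

Lemma alphaMbeta : alpha C p q * beta C p q = q%:~R.
Proof.
(* [field] treats the square root as an atom, so its square must be exposed and replaced by hand. *)
have sqr_sqrt : sqrtC (discr p q)%:~R ^+ 2 = p%:~R ^+ 2 - 4 * q%:~R :> C.
  by rewrite sqrtCK /discr rmorphB rmorphXn rmorphM.
have -> : alpha C p q * beta C p q
        = (p%:~R ^+ 2 - sqrtC (discr p q)%:~R ^+ 2) / 4.
  by rewrite /alpha /beta; field.
by rewrite sqr_sqrt; field.
Qed.

Lemma lucasV0 : V 0 = 2.
Proof. by rewrite /lucasV !expr0. Qed.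

Lemma lucasV1 : V 1 = p%:~R.
Proof. exact: alphaDbeta. Qed.

Lemma lucasVSS n : V n.+2 = p%:~R * V n.+1 - q%:~R * V n.
(* Writing [p] and [q] through the roots leaves a polynomial identity in [alpha], [beta] and their
   powers. *)
Proof. by rewrite -alphaDbeta -alphaMbeta /lucasV !exprS; ring. Qed.

Lemma lucasV2_double m : V2 m.*2 = V m ^+ 2.
Proof. by rewrite /lucasV2 odd_double doubleK mul1r. Qed.

Lemma lucasV2_doubleS m : V2 m.*2.+1 = V m.+1 * V m.
Proof. by rewrite /lucasV2 /= odd_double uphalf_double. Qed.

Lemma lucasV2_rec n :
  V2 n.+4 = p%:~R * V2 n.+3 - p%:~R * q%:~R * V2 n.+1 + q%:~R ^+ 2 * V2 n.
Proof.
(* Either parity leaves a polynomial identity in [V n./2] and [V (n./2).+1]. *)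
rewrite -(odd_double_half n); case: (odd n); rewrite ?add1n ?add0n.
  by rewrite -!doubleS !lucasV2_doubleS !lucasV2_double !lucasVSS; ring.
by rewrite -!doubleS !lucasV2_doubleS !lucasV2_double !lucasVSS; ring.
Qed.

End LucasRecurrence.

Theorem theorem6 (C : numClosedFieldType) (p q : int) :
  let x : {fps C} := fpsX C in
  let P : {fps C} := p%:~R in
  let Q : {fps C} := q%:~R in
  gen_lucasV2 C p q =
    (4 - 2 * P * x - P ^+ 2 * x ^+ 2 + 2 * P * Q * x ^+ 3)
    / (1 - P * x + P * Q * x ^+ 3 - Q ^+ 2 * x ^+ 4).
Proof.
move=> x P Q; set N := (N in N / _); set D := (D in _ / D).
(* Nesting turns powers of [x] into repeated shifts, so the coefficient rules for left factors
   apply. *)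
have D_nested (f : {fps C}) :
  D * f = f - P * (x * f) + P * (Q * (x * (x * (x * f))))
          - Q * (Q * (x * (x * (x * (x * f))))).
  by rewrite /D; ring.
have N_nested : N = 4%:~R * 1 - 2%:~R * (P * (x * 1)) - P * (P * (x * (x * 1)))
                    + 2%:~R * (P * (Q * (x * (x * (x * 1))))).
  by rewrite /N; ring.
have coefE := (coef_fpsD, coef_fpsN, coef_fps_intM, coef_fpsXM, coef_fps1).
have D_unit : D \is a GRing.unit.
  by rewrite fps_unitE -[D]mulr1 D_nested !coefE /= !mulr0 !subr0 addr0 unitr1.
apply: (mulIr D_unit); rewrite divrK // mulrC D_nested N_nested.
have V20 : lucasV2 C p q 0 = 4.
  by rewrite (lucasV2_double C p q 0) lucasV0; ring.
have V21 : lucasV2 C p q 1 = p%:~R * 2.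
  by rewrite (lucasV2_doubleS C p q 0) lucasV1 lucasV0.
have V22 : lucasV2 C p q 2 = p%:~R ^+ 2.
  by rewrite (lucasV2_double C p q 1) lucasV1.
have V23 : lucasV2 C p q 3 = (p%:~R ^+ 2 - q%:~R * 2) * p%:~R.
  by rewrite (lucasV2_doubleS C p q 1) lucasVSS lucasV1 lucasV0.
(* Coefficients 0 to 3 use the initial values; from 4 on the numerator contributes 0 and the
   recurrence closes the goal. *)
by apply: fpsP => -[|[|[|[|n]]]]; rewrite !coefE /= ?lucasV2_rec
  ?V20 ?V21 ?V22 ?V23; ring.
Qed.
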